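(* For any $x,y\in\mathbb{C}^M$: (1) $x\sim y$ if and only if $xx^{\ast}=yy^{\ast}$; (2) $x\overset{\mathrm{conj}}{\sim}y$ if and only if $\mathrm{Re}(xx^{\ast})=\mathrm{Re}(yy^{\ast})$.
   Context: For $x,y\in\mathbb{C}^M$ (column vectors): $x\sim y$ means $x=e^{i\theta}y$ for some $\theta\in[0,2\pi)$; $\overline{y}$ is the coordinatewise complex conjugate of $y$; $x\overset{\mathrm{conj}}{\sim}y$ means $x\sim y$ or $x\sim\overline{y}$. $\ast$ denotes conjugate transpose, so $xx^{\ast}$ is the $M\times M$ matrix with entries $x_i\overline{x_j}$. For a complex matrix $H=[h_{ij}]$, $\mathrm{Re}(H)=[\mathrm{Re}(h_{ij})]$ is the entrywise real part. *)

(* Defs.v *)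
From mathcomp Require Export all_boot all_order all_algebra.
From mathcomp Require Export reals trigo.
From mathcomp Require Export complex.

Set Implicit Arguments.
Unset Strict Implicit.
Unset Printing Implicit Defensive.

Import GRing.Theory Num.Theory.
Local Open Scope ring_scope.

(* The libraries have no complex exponential: e^{i theta} is given by Euler's
   formula. *)
Definition expi (R : realType) (theta : R) : R[i] :=
  (cos theta +i* sin theta)%C.

Definition phase_equiv (R : realType) (M : nat) (x y : 'cV[R[i]]_M) : Prop :=
  exists theta : R, 0 <= theta < 2 * pi /\ x = expi theta *: y.

Definition conj_phase_equiv (R : realType) (M : nat)
    (x y : 'cV[R[i]]_M) : Prop :=
  phase_equiv x y \/ phase_equiv x (map_mx Num.conj y).

Definition Remx (R : realType) (m n : nat) (H : 'M[R[i]]_(m, n)) :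
    'M[R]_(m, n) :=
  map_mx (@complex.Re R) H.

(* Main.v *)
Require Import Defs.
From mathcomp Require Import ring lra.

Set Implicit Arguments.
Unset Strict Implicit.
Unset Printing Implicit Defensive.

Import Order.TTheory GRing.Theory Num.Theory.

(** Read the entries of a vector as points of the plane: the entries of
    [x *m x ^t*] are the products [x_i * conj x_j], and their real parts are
    the scalar products of those points.  The theorem says that the Hermitian
    products determine the points up to a rotation, and the scalar products
    determine them up to a rotation or a reflection.

    If [y = 0], the diagonal entries force [x = 0].  Otherwise fix [k] with
    [y_k != 0]; since [x_k] and [y_k] have the same modulus, it suffices to
    show that [conj x_k *: x] equals [conj y_k *: y] (for a rotation) or
    [y_k *: conj y] (for a reflection): dividing by [conj x_k] leaves a scalar
    of modulus one, which is some [expi theta]; see [phase_equiv_scale].  In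
    part (1) this equality is a column of the hypothesis.  In part (2), put
    [u_i = conj x_k * x_i] and [v_i = conj y_k * y_i].  The hypothesis gives
    [Re u_i = Re v_i], and as it also gives the scalar products of the [u_i],
    it yields [Im u_i * Im u_j = Im v_i * Im v_j] for all [i] and [j].  A real
    family is determined up to one global sign by its pairwise products
    ([eq_or_opp_of_mul]), so [u = v] or [u = conj v]. *)

Local Open Scope ring_scope.
Local Open Scope sesquilinear_scope.

Lemma eq_or_opp_of_mul (R : idomainType) (I : finType) (s t : I -> R) :
    (forall i j, s i * s j = t i * t j) ->
  (forall i, s i = t i) \/ (forall i, s i = - t i).
Proof.
move=> st.
have [t0|] := boolP [forall i, t i == 0].
  left=> i; have /eqP ti0 := forallP t0 i; apply/eqP.
  by move/eqP: (st i i); rewrite ti0 mul0r mulf_eq0 orbb.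
rewrite negb_forall => /existsP[l tl_neq0].
have /eqP := st l l; rewrite -!expr2 eqf_sqr => /orP[] /eqP sl;
  [left | right] => i; apply: (mulIf tl_neq0).
  by rewrite -{1}sl st.
by rewrite mulNr -st sl mulrN opprK.
Qed.

(** [acos] gives an angle in [[0, pi]] with the right cosine; when the sine is
    to be negative, the angle is reflected to [2 * pi - acos a]. *)
Lemma expi_surj (R : realType) (c : R[i]) :
  c * c^* = 1 -> exists theta : R, 0 <= theta < 2 * pi /\ c = expi theta.
Proof.
case: c => a b [cc1 _].
have ab1 : a ^+ 2 + b ^+ 2 = 1 by rewrite -cc1; ring.
have a_int : -1 <= a <= 1 by apply/andP; split; nra.
have cosa : cos (acos a) = a by apply: acosK; rewrite in_itv.
have sina : sin (acos a) = `|b|.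
  by rewrite sin_acos // -sqrtr_sqr; congr Num.sqrt; lra.
have := acos_ge0 a_int; have := acos_lepi a_int; have := pi_gt0 R.
move=> pi0 api a0; have [b0|b0] := leP 0 b.
  exists (acos a); split; first by apply/andP; split; lra.
  by rewrite /expi cosa sina ger0_norm.
exists (- acos a + pi *+ 2); split; last first.
  by rewrite /expi cosD2pi sinD2pi cosN sinN cosa sina ltr0_norm ?opprK.
(* The angle [2 * pi] is excluded: [acos a = 0] would make [b] vanish. *)
have a_gt0 : 0 < acos a.
  rewrite lt_neqAle a0 andbT; apply: contraTneq b0 => a0'.
  by move: sina; rewrite -a0' sin0 => /esym/normr0_eq0 ->; rewrite ltxx.
by rewrite mulr2n; apply/andP; split; lra.
Qed.

Lemma expi_mul_conj (R : realType) (theta : R) :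
  expi theta * (expi theta)^* = 1.
Proof.
apply/eqP; rewrite eq_complex /=; apply/andP; split; apply/eqP; last by ring.
by rewrite -(cos2Dsin2 theta); ring.
Qed.

Lemma phase_equiv_scale (R : realType) (M : nat) (x y : 'cV[R[i]]_M)
    (a b : R[i]) :
  b != 0 -> a * a^* = b * b^* -> a *: x = b *: y -> phase_equiv x y.
Proof.
move=> b0 ab xy.
have a0 : a != 0.
  apply: contraNneq b0 => a0; move/eqP: ab.
  by rewrite a0 mul0r eq_sym mulf_eq0 conjC_eq0 orbb.
have [|theta [theta_int ctheta]] := @expi_surj R (b / a).
  by rewrite rmorphM fmorphV mulrACA -invfM -ab mulfV // mulf_neq0 ?conjC_eq0.
exists theta; split=> //.
by rewrite -ctheta mulrC -scalerA -xy scalerA mulVf // scale1r.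
Qed.

Lemma phase_equiv_refl (R : realType) (M : nat) (x : 'cV[R[i]]_M) :
  phase_equiv x x.
Proof.
exists 0; split; first by rewrite lexx mulr_gt0 ?pi_gt0.
by rewrite /expi cos0 sin0 scale1r.
Qed.

Lemma outerE (R : realType) (M : nat) (x : 'cV[R[i]]_M) i j :
  (x *m x ^t*) i j = x i 0 * (x j 0)^*.
Proof. by rewrite !mxE big_ord1 !mxE. Qed.

Lemma phase_equiv_outer (R : realType) (M : nat) (x y : 'cV[R[i]]_M) :
  phase_equiv x y -> x *m x ^t* = y *m y ^t*.
Proof.
case=> theta [_ ->]; apply/matrixP => i j; rewrite !outerE !mxE.
by rewrite rmorphM mulrACA expi_mul_conj mul1r.
Qed.

Lemma Remx_outer_conj (R : realType) (M : nat) (y : 'cV[R[i]]_M) :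
  Remx (map_mx Num.conj y *m (map_mx Num.conj y) ^t*) = Remx (y *m y ^t*).
Proof.
apply/matrixP => i j; rewrite mxE [RHS]mxE !outerE !mxE -rmorphM.
by case: (y i 0 * _).
Qed.

Lemma Remx_outerE (R : realType) (M : nat) (x y : 'cV[R[i]]_M) :
    Remx (x *m x ^t*) = Remx (y *m y ^t*) ->
  forall i j, complex.Re (x i 0 * (x j 0)^*) = complex.Re (y i 0 * (y j 0)^*).
Proof. by move=> /matrixP xy i j; have := xy i j; rewrite !mxE -!outerE !mxE. Qed.

Lemma mul_conj_Re (R : realType) (z : R[i]) :
  z * z^* = (complex.Re (z * z^*))%:C%C.
Proof.
by case: z => a b; apply/eqP; rewrite eq_complex /= eqxx; apply/eqP; ring.
Qed.

(** With [u = conj z * a] and [w = conj z * b], this is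
    [Im u * Im w = Re (u * conj w) - Re u * Re w], where
    [u * conj w = `|z| ^ 2 * (a * conj b)]: imaginary parts of rotated entries
    are expressed through scalar products alone. *)
Lemma mul_Im_conj (R : realType) (z a b : R[i]) :
  complex.Im (z^* * a) * complex.Im (z^* * b) =
  complex.Re (z * z^*) * complex.Re (a * b^*)
  - complex.Re (a * z^*) * complex.Re (b * z^*).
Proof. by case: z a b => [z1 z2] [a1 a2] [b1 b2] /=; ring. Qed.

Lemma phase_equiv_of_outer (R : realType) (M : nat) (x y : 'cV[R[i]]_M) k :
  y k 0 != 0 -> x *m x ^t* = y *m y ^t* -> phase_equiv x y.
Proof.
move=> yk0 /matrixP xy.
have {}xy i j : x i 0 * (x j 0)^* = y i 0 * (y j 0)^* by rewrite -!outerE.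
apply: (@phase_equiv_scale _ _ _ _ (x k 0)^* (y k 0)^*).
- by rewrite conjC_eq0.
- by rewrite !conjCK mulrC xy mulrC.
- by apply/matrixP => i j; rewrite ord1 !mxE mulrC xy mulrC.
Qed.

Lemma conj_phase_equiv_of_Remx_outer (R : realType) (M : nat)
    (x y : 'cV[R[i]]_M) k :
  y k 0 != 0 -> Remx (x *m x ^t*) = Remx (y *m y ^t*) -> conj_phase_equiv x y.
Proof.
move=> yk0 /Remx_outerE xy.
have nk : x k 0 * (x k 0)^* = y k 0 * (y k 0)^*.
  by rewrite mul_conj_Re xy -mul_conj_Re.
pose u i := (x k 0)^* * x i 0; pose v i := (y k 0)^* * y i 0.
have Re_uv i : complex.Re (u i) = complex.Re (v i).
  by rewrite /u /v mulrC xy mulrC.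
have Im_uv i j : complex.Im (u i) * complex.Im (u j) =
                 complex.Im (v i) * complex.Im (v j).
  by rewrite !mul_Im_conj !xy.
have [Im_eq|Im_opp] := eq_or_opp_of_mul Im_uv; [left | right].
- apply: (@phase_equiv_scale _ _ _ _ (x k 0)^* (y k 0)^*).
  + by rewrite conjC_eq0.
  + by rewrite !conjCK mulrC nk mulrC.
  + apply/matrixP => i j; rewrite ord1 !mxE -/(u i) -/(v i).
    by apply/eqP; rewrite eq_complex Re_uv Im_eq !eqxx.
- apply: (@phase_equiv_scale _ _ _ _ (x k 0)^* (y k 0)) => //.
  + by rewrite conjCK mulrC.
  + apply/matrixP => i j; rewrite ord1 !mxE -/(u i).
    have -> : y k 0 * (y i 0)^* = (v i)^* by rewrite /v rmorphM /= conjCK.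
    apply/eqP; rewrite eq_complex Re_uv Im_opp.
    by case: (v i) => p q /=; rewrite !eqxx.
Qed.

Lemma Remx_outer_eq0 (R : realType) (M : nat) (x : 'cV[R[i]]_M) :
  Remx (x *m x ^t*) = 0 -> x = 0.
Proof.
move=> /matrixP x0; apply/matrixP => i j; rewrite ord1 mxE.
have := x0 i i; rewrite [LHS]mxE outerE mxE => xi0.
apply/eqP; have /eqP := mul_conj_Re (x i 0).
by rewrite xi0 mulf_eq0 conjC_eq0 orbb.
Qed.

Lemma Remx_outer0 (R : realType) (M : nat) :
  Remx (0 *m (0 : 'cV[R[i]]_M) ^t*) = 0 :> 'M_M.
Proof. by rewrite mul0mx; apply/matrixP => i j; rewrite !mxE. Qed.

Theorem theorem2p1 (R : realType) (M : nat) (x y : 'cV[R[i]]_M) :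
  (phase_equiv x y <-> x *m x ^t* = y *m y ^t*) /\
  (conj_phase_equiv x y <-> Remx (x *m x ^t*) = Remx (y *m y ^t*)).
Proof.
split; split.
- exact: phase_equiv_outer.
- have [->|/matrix0Pn[k [j]]] := eqVneq y 0.
    move=> /(congr1 (@Remx _ _ _)); rewrite Remx_outer0 => /Remx_outer_eq0 ->.
    exact: phase_equiv_refl.
  by rewrite ord1; apply: phase_equiv_of_outer.
- by case=> /phase_equiv_outer -> //; apply: Remx_outer_conj.
- have [->|/matrix0Pn[k [j]]] := eqVneq y 0.
    by rewrite Remx_outer0 => /Remx_outer_eq0 ->; left; apply: phase_equiv_refl.
  by rewrite ord1; apply: conj_phase_equiv_of_Remx_outer.
Qed.
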